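(* Let $\alpha\colon\frac XG\to\frac ZK$ and $\beta\colon\frac YH\to\frac ZK$ be any pair of 1-cells in $\mathbb S$, and let $\mathrm{pr}^{(G)}\colon G\times H\to G$, $\mathrm{pr}^{(H)}\colon G\times H\to H$ be the projections. Put $$F=\{(x,y,k)\in X\times Y\times K\mid \beta(y)=k\,\alpha(x)\},\qquad \wp_X(x,y,k)=x,\quad \wp_Y(x,y,k)=y,$$ equip $F$ with the $G\times H$-action $$(g,h)(x,y,k)=(gx,\ hy,\ \theta_{\beta,y}(h)\,k\,\theta_{\alpha,x}(g)^{-1}),$$ and define a 2-cell $\kappa\colon\alpha\circ\wp_X\Rightarrow\beta\circ\wp_Y$ by $\kappa_{(x,y,k)}=k$. Then $\frac{F}{G\times H}$, together with the 1-cells $\frac{\wp_X}{\mathrm{pr}^{(G)}}\colon\frac F{G\times H}\to\frac XG$, $\frac{\wp_Y}{\mathrm{pr}^{(H)}}\colon\frac F{G\times H}\to\frac YH$ and the 2-cell $\kappa$, is a bipullback of $\alpha$ and $\beta$ in $\mathbb S$.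
   Context: All groups and group-sets are finite. **The 2-category $\mathbb S$.** A 0-cell is a pair $\frac XG$ of a finite group $G$ and a finite left $G$-set $X$. A 1-cell $\alpha=\frac{\alpha}{\theta_\alpha}\colon \frac XG\to\frac YH$ is a map $\alpha\colon X\to Y$ together with a family $\theta_\alpha=\{\theta_{\alpha,x}\colon G\to H\}_{x\in X}$ of maps such that $\alpha(gx)=\theta_{\alpha,x}(g)\alpha(x)$ and $\theta_{\alpha,x}(gg')=\theta_{\alpha,g'x}(g)\,\theta_{\alpha,x}(g')$ for all $x\in X$, $g,g'\in G$. The composite $\beta\circ\alpha$ is the composite of maps with $\theta_{\beta\circ\alpha,x}=\theta_{\beta,\alpha(x)}\circ\theta_{\alpha,x}$; the identity has $\theta_x=\mathrm{id}_G$. A 2-cell $\varepsilon\colon\alpha\Rightarrow\alpha'$ between 1-cells $\alpha,\alpha'\colon\frac XG\to\frac YH$ is a map $X\to H$, $x\mapsto\varepsilon_x$, with $\alpha'(x)=\varepsilon_x\alpha(x)$ and $\varepsilon_{gx}\theta_{\alpha,x}(g)\varepsilon_x^{-1}=\theta_{\alpha',x}(g)$. Vertical composition: $(\varepsilon'\cdot\varepsilon)_x=\varepsilon'_x\varepsilon_x$; all 2-cells are invertible. Whiskering: $(\beta\circ\varepsilon)_x=\theta_{\beta,\alpha(x)}(\varepsilon_x)$ and $(\delta\circ\alpha)_x=\delta_{\alpha(x)}$. For a group homomorphism $f\colon G\to H$, $\frac{\alpha}{f}$ denotes a 1-cell with $\theta_{\alpha,x}=f$ for all $x$. **Bipullbacks.**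 In a 2-category with invertible 2-cells, a bipullback of $f_i\colon A_i\to B$ ($i=1,2$) is a 0-cell $P$ with 1-cells $\pi_i\colon P\to A_i$ and a 2-cell $\kappa\colon f_1\circ\pi_1\Rightarrow f_2\circ\pi_2$ such that: (i) for any 1-cells $g_i\colon X\to A_i$ and 2-cell $\varepsilon\colon f_1\circ g_1\Rightarrow f_2\circ g_2$ there are a 1-cell $g\colon X\to P$ and 2-cells $\xi_i\colon\pi_i\circ g\Rightarrow g_i$ with $\varepsilon\cdot(f_1\circ\xi_1)=(f_2\circ\xi_2)\cdot(\kappa\circ g)$; (ii) for any two such triples $(g,\xi_1,\xi_2)$, $(g',\xi_1',\xi_2')$ there is a unique 2-cell $\zeta\colon g\Rightarrow g'$ with $\xi'_i\cdot(\pi_i\circ\zeta)=\xi_i$ ($i=1,2$). *)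

(* Defs.v *)
From mathcomp Require Import all_boot all_fingroup.
From Stdlib Require Import FunctionalExtensionality.

Set Implicit Arguments.
Unset Strict Implicit.
Unset Printing Implicit Defensive.

Import GroupScope.

Declare Scope cell_scope.
Delimit Scope cell_scope with C.
Reserved Notation "f \=> g" (at level 70, no associativity).
Reserved Notation "g \oc f" (at level 40, left associativity).
Reserved Notation "e' \v e" (at level 50, left associativity).
Reserved Notation "g \wl e" (at level 40, left associativity).
Reserved Notation "d \wr f" (at level 40, left associativity).
Reserved Notation "g *> x" (at level 41, right associativity).

(* Composition of 1-cells is strictly associative and unital, but only up to
   propositional equality; [cast2] moves a 2-cell along such equalities of its
   source and target. *)
Definition cast2 (T : Type) (R : T -> T -> Type) (f f' g g' : T)
    (ef : f = f') (eg : g = g') (e : R f g) : R f' g' :=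
  match ef in _ = u, eg in _ = v return R u v with
  | erefl, erefl => e
  end.

Record twocat_data := TwoCatData {
  cell0 :> Type;
  cell1 : cell0 -> cell0 -> Type;
  cell2 : forall A B : cell0, cell1 A B -> cell1 A B -> Type;
  id1 : forall A : cell0, cell1 A A;
  comp1 : forall A B C : cell0, cell1 B C -> cell1 A B -> cell1 A C;
  id2 : forall (A B : cell0) (f : cell1 A B), cell2 f f;
  vcomp : forall (A B : cell0) (f f' f'' : cell1 A B),
    cell2 f' f'' -> cell2 f f' -> cell2 f f'';
  whiskl : forall (A B C : cell0) (g : cell1 B C) (f f' : cell1 A B),
    cell2 f f' -> cell2 (comp1 g f) (comp1 g f');
  whiskr : forall (A B C : cell0) (g g' : cell1 B C),
    cell2 g g' -> forall f : cell1 A B, cell2 (comp1 g f) (comp1 g' f)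
}.

Arguments id1 {_} A.
Arguments id2 {_ A B} f.
Notation "f \=> g" := (cell2 f g) : cell_scope.
Notation "g \oc f" := (comp1 g f) : cell_scope.
Notation "e' \v e" := (vcomp e' e) : cell_scope.
Notation "g \wl e" := (whiskl g e) : cell_scope.
Notation "d \wr f" := (whiskr d f) : cell_scope.

Local Open Scope cell_scope.

(* Strict 2-categories in which every 2-cell is invertible; horizontal
   composition is presented by the two whiskerings and the interchange law. *)
Record twocat_laws (K : twocat_data) : Prop := TwoCatLaws {
  comp1A : forall (A B C D : K)
    (h : cell1 C D) (g : cell1 B C) (f : cell1 A B),
    h \oc (g \oc f) = (h \oc g) \oc f;
  comp1_idl : forall (A B : K) (f : cell1 A B), id1 B \oc f = f;
  comp1_idr : forall (A B : K) (f : cell1 A B), f \oc id1 A = f;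
  vcompA : forall (A B : K) (f0 f1 f2 f3 : cell1 A B)
    (e'' : f2 \=> f3) (e' : f1 \=> f2) (e : f0 \=> f1),
    e'' \v (e' \v e) = (e'' \v e') \v e;
  vcomp_idl : forall (A B : K) (f f' : cell1 A B) (e : f \=> f'),
    id2 f' \v e = e;
  vcomp_idr : forall (A B : K) (f f' : cell1 A B) (e : f \=> f'),
    e \v id2 f = e;
  cell2_inv : forall (A B : K) (f f' : cell1 A B) (e : f \=> f'),
    exists e' : f' \=> f, e' \v e = id2 f /\ e \v e' = id2 f';
  whiskl_id2 : forall (A B C : K) (g : cell1 B C) (f : cell1 A B),
    g \wl id2 f = id2 (g \oc f);
  whiskl_vcomp : forall (A B C : K) (g : cell1 B C)
    (f f' f'' : cell1 A B) (e' : f' \=> f'') (e : f \=> f'),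
    g \wl (e' \v e) = (g \wl e') \v (g \wl e);
  whiskr_id2 : forall (A B C : K) (g : cell1 B C) (f : cell1 A B),
    id2 g \wr f = id2 (g \oc f);
  whiskr_vcomp : forall (A B C : K) (g g' g'' : cell1 B C)
    (d' : g' \=> g'') (d : g \=> g') (f : cell1 A B),
    (d' \v d) \wr f = (d' \wr f) \v (d \wr f);
  whiskl_idl : forall (A B : K) (f f' : cell1 A B) (e : f \=> f'),
    cast2 (comp1_idl f) (comp1_idl f') (id1 B \wl e) = e;
  whiskr_idr : forall (A B : K) (f f' : cell1 A B) (e : f \=> f'),
    cast2 (comp1_idr f) (comp1_idr f') (e \wr id1 A) = e;
  whiskl_comp : forall (A B C D : K)
    (h : cell1 C D) (g : cell1 B C) (f f' : cell1 A B) (e : f \=> f'),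
    cast2 (comp1A h g f) (comp1A h g f') (h \wl (g \wl e)) = (h \oc g) \wl e;
  whiskr_comp : forall (A B C D : K)
    (h h' : cell1 C D) (d : h \=> h') (g : cell1 B C) (f : cell1 A B),
    cast2 (comp1A h g f) (comp1A h' g f) (d \wr (g \oc f)) = (d \wr g) \wr f;
  whisklr : forall (A B C D : K)
    (h : cell1 C D) (g g' : cell1 B C) (d : g \=> g') (f : cell1 A B),
    cast2 (comp1A h g f) (comp1A h g' f) (h \wl (d \wr f)) = (h \wl d) \wr f;
  interchange : forall (A B C : K) (g g' : cell1 B C)
    (f f' : cell1 A B) (d : g \=> g') (e : f \=> f'),
    (d \wr f') \v (g \wl e) = (g' \wl e) \v (d \wr f)
}.

Record twocat := TwoCat {
  twocat_sort :> twocat_data;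
  twocatP : twocat_laws twocat_sort
}.

Section Bipullback.

Variables (C : twocat) (A1 A2 B P : C).
Variables (f1 : cell1 A1 B) (f2 : cell1 A2 B).
Variables (p1 : cell1 P A1) (p2 : cell1 P A2).
Variable kappa : f1 \oc p1 \=> f2 \oc p2.

(* The cast reads [kappa \wr g] as a 2-cell
   [f1 \oc (p1 \oc g) \=> f2 \oc (p2 \oc g)]. *)
Definition is_filler (X : C) (g1 : cell1 X A1) (g2 : cell1 X A2)
    (e : f1 \oc g1 \=> f2 \oc g2) (g : cell1 X P)
    (xi1 : p1 \oc g \=> g1) (xi2 : p2 \oc g \=> g2) : Prop :=
  e \v (f1 \wl xi1) =
  (f2 \wl xi2) \v
    cast2 (esym (comp1A (twocatP C) f1 p1 g)) (esym (comp1A (twocatP C) f2 p2 g)) (kappa \wr g).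

Definition is_bipullback : Prop :=
  (forall (X : C) (g1 : cell1 X A1) (g2 : cell1 X A2)
     (e : f1 \oc g1 \=> f2 \oc g2),
     exists (g : cell1 X P) (xi1 : p1 \oc g \=> g1) (xi2 : p2 \oc g \=> g2),
       is_filler e xi1 xi2) /\
  (forall (X : C) (g1 : cell1 X A1) (g2 : cell1 X A2)
     (e : f1 \oc g1 \=> f2 \oc g2)
     (g : cell1 X P) (xi1 : p1 \oc g \=> g1) (xi2 : p2 \oc g \=> g2)
     (g' : cell1 X P) (xi1' : p1 \oc g' \=> g1) (xi2' : p2 \oc g' \=> g2),
     is_filler e xi1 xi2 -> is_filler e xi1' xi2' ->
     exists! zeta : g \=> g',
       xi1' \v (p1 \wl zeta) = xi1 /\ xi2' \v (p2 \wl zeta) = xi2).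

End Bipullback.

Arguments is_bipullback C {A1 A2 B P} f1 f2 p1 p2 kappa.

(* MathComp's [{action aT &-> T}] is a right action, hence this structure for
   left actions. *)
Record gset := GSet {
  grp : finGroupType;
  pts :> finType;
  lact : grp -> pts -> pts;
  lact1 : forall x, lact 1 x = x;
  lactM : forall g g' x, lact (g * g') x = lact g (lact g' x)
}.

Notation "g *> x" := (lact g x) : group_scope.

(* A 1-cell is not a G-map: [theta] may depend on the point, in the manner of a
   cocycle. *)
Record onecell (X Y : gset) := OneCell {
  map1 :> X -> Y;
  theta : X -> grp X -> grp Y;
  map1_act : forall x g, map1 (g *> x) = theta x g *> map1 x;
  thetaM : forall x g g', theta x (g * g') = theta (g' *> x) g * theta x g'
}.

Record twocell (X Y : gset) (a a' : onecell X Y) := TwoCell {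
  map2 :> X -> grp Y;
  map2_act : forall x, a' x = map2 x *> a x;
  map2_theta : forall x g,
    map2 (g *> x) * theta a x g * (map2 x)^-1 = theta a' x g
}.

(* The laws of [onecell] and [twocell] are equations in [eqType]s, so cells are
   determined by their underlying maps, by functional extensionality. *)
Lemma onecell_eq (X Y : gset) (a b : onecell X Y) :
  a =1 b -> (forall x g, theta a x g = theta b x g) -> a = b.
Proof.
case: a b => [m t mP tP] [m' t' mP' tP'] /= em et.
have {}em : m = m' by apply: functional_extensionality.
have {}et : t = t'.
  by do 2![apply: functional_extensionality => ?]; apply: et.
rewrite {m}em {t}et in mP tP *.
have -> : mP = mP'.
  by do 2![apply: functional_extensionality_dep => ?]; apply: eq_irrelevance.
have -> // : tP = tP'.
by do 3![apply: functional_extensionality_dep => ?]; apply: eq_irrelevance.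
Qed.

Lemma twocell_eq (X Y : gset) (a a' : onecell X Y) (e e' : twocell a a') :
  e =1 e' -> e = e'.
Proof.
case: e e' => [m P Q] [m' P' Q'] /= em.
have {}em : m = m' by apply: functional_extensionality.
rewrite {m}em in P Q *.
have -> : P = P'.
  by apply: functional_extensionality_dep => ?; apply: eq_irrelevance.
have -> // : Q = Q'.
by do 2![apply: functional_extensionality_dep => ?]; apply: eq_irrelevance.
Qed.

Lemma cast2E (X Y : gset) (a a' b b' : onecell X Y) (ea : a = a') (eb : b = b')
  (e : twocell a b) : cast2 (R := @twocell X Y) ea eb e =1 e.
Proof. by case: _ / ea; case: _ / eb. Qed.

Section Operations.

Definition id_onecell (X : gset) : onecell X X :=
  @OneCell X X id (fun _ g => g) (fun _ _ => erefl) (fun _ _ _ => erefl).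

Section Comp.
Variables (X Y Z : gset) (b : onecell Y Z) (a : onecell X Y).

Fact comp_map1_act x g : b (a (g *> x)) = theta b (a x) (theta a x g) *> b (a x).
Proof. by rewrite !map1_act. Qed.

Fact comp_thetaM x g g' : theta b (a x) (theta a x (g * g')) =
  theta b (a (g' *> x)) (theta a (g' *> x) g) * theta b (a x) (theta a x g').
Proof. by rewrite !thetaM map1_act. Qed.

Definition comp_onecell : onecell X Z :=
  @OneCell X Z (fun x => b (a x)) (fun x g => theta b (a x) (theta a x g))
    comp_map1_act comp_thetaM.
End Comp.

Variables X Y Z : gset.

Fact id_map2_act (a : onecell X Y) x : a x = 1 *> a x.
Proof. by rewrite lact1. Qed.

Fact id_map2_theta (a : onecell X Y) x g :
  1 * theta a x g * 1^-1 = theta a x g.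
Proof. by rewrite mul1g invg1 mulg1. Qed.

Definition id_twocell (a : onecell X Y) : twocell a a :=
  @TwoCell X Y a a (fun=> 1) (id_map2_act a) (id_map2_theta a).

Section Vcomp.
Variables (a a' a'' : onecell X Y) (e' : twocell a' a'') (e : twocell a a').

Fact vcomp_map2_act x : a'' x = (e' x * e x) *> a x.
Proof. by rewrite (map2_act e') (map2_act e) lactM. Qed.

Fact vcomp_map2_theta x g :
  e' (g *> x) * e (g *> x) * theta a x g * (e' x * e x)^-1 = theta a'' x g.
Proof. by rewrite -(map2_theta e') -(map2_theta e) invMg !mulgA. Qed.

Definition vcomp_twocell : twocell a a'' :=
  @TwoCell X Y a a'' (fun x => e' x * e x) vcomp_map2_act vcomp_map2_theta.
End Vcomp.

Lemma theta1 (a : onecell X Y) x : theta a x 1 = 1.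
Proof.
apply: (mulgI (theta a x 1)).
by have := thetaM a x 1 1; rewrite lact1 !mulg1 => <-.
Qed.

End Operations.

Section Whiskering.
Variables X Y Z : gset.

Section Left.
Variables (b : onecell Y Z) (a a' : onecell X Y) (e : twocell a a').

Fact whiskl_map2_act x :
  comp_onecell b a' x = theta b (a x) (e x) *> comp_onecell b a x.
Proof. by rewrite /= -map1_act -map2_act. Qed.

Fact whiskl_map2_theta x g :
  theta b (a (g *> x)) (e (g *> x)) * theta (comp_onecell b a) x g
    * (theta b (a x) (e x))^-1 = theta (comp_onecell b a') x g.
Proof.
apply: (mulIg (theta b (a x) (e x))); rewrite mulgKV /=.
rewrite map1_act -thetaM (map2_act e) -thetaM.
by rewrite -(map2_theta e) mulgKV.
Qed.

Definition whiskl_twocell : twocell (comp_onecell b a) (comp_onecell b a') :=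
  @TwoCell X Z _ _ (fun x => theta b (a x) (e x))
    whiskl_map2_act whiskl_map2_theta.
End Left.

Section Right.
Variables (b b' : onecell Y Z) (d : twocell b b') (a : onecell X Y).

Fact whiskr_map2_act x :
  comp_onecell b' a x = d (a x) *> comp_onecell b a x.
Proof. exact: (map2_act d). Qed.

Fact whiskr_map2_theta x g :
  d (a (g *> x)) * theta (comp_onecell b a) x g * (d (a x))^-1
  = theta (comp_onecell b' a) x g.
Proof. by rewrite map1_act (map2_theta d). Qed.

Definition whiskr_twocell : twocell (comp_onecell b a) (comp_onecell b' a) :=
  @TwoCell X Z _ _ (fun x => d (a x)) whiskr_map2_act whiskr_map2_theta.
End Right.

End Whiskering.

Section Inverse.
Variables (X Y : gset) (a a' : onecell X Y) (e : twocell a a').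

Fact inv_map2_act x : a x = (e x)^-1 *> a' x.
Proof. by rewrite (map2_act e) -lactM mulVg lact1. Qed.

Fact inv_map2_theta x g :
  (e (g *> x))^-1 * theta a' x g * ((e x)^-1)^-1 = theta a x g.
Proof. by rewrite -(map2_theta e) invgK -!mulgA mulKg mulVg mulg1. Qed.

Definition inv_twocell : twocell a' a :=
  @TwoCell X Y a' a (fun x => (e x)^-1) inv_map2_act inv_map2_theta.
End Inverse.

Definition SS_data : twocat_data :=
  @TwoCatData gset onecell twocell id_onecell comp_onecell id_twocell
    vcomp_twocell whiskl_twocell whiskr_twocell.

Lemma SS_laws : twocat_laws SS_data.
Proof.
unshelve refine (@TwoCatLaws SS_data _ _ _ _ _ _ _ _ _ _ _ _ _ _ _ _ _) => /=.
- by move=> A B C D h g f; apply: onecell_eq.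
- by move=> A B f; apply: onecell_eq.
- by move=> A B f; apply: onecell_eq.
- by move=> *; apply: twocell_eq => x /=; rewrite mulgA.
- by move=> *; apply: twocell_eq => x /=; rewrite mul1g.
- by move=> *; apply: twocell_eq => x /=; rewrite mulg1.
- move=> A B f f' e; exists (inv_twocell e).
  by split; apply: twocell_eq => x /=; rewrite ?mulVg ?mulgV.
- by move=> *; apply: twocell_eq => x /=; rewrite theta1.
- move=> A B C g f f' f'' e' e; apply: twocell_eq => x /=.
  by rewrite thetaM (map2_act e).
- by move=> *; apply: twocell_eq.
- by move=> *; apply: twocell_eq.
- by move=> *; apply: twocell_eq => x; rewrite cast2E.
- by move=> *; apply: twocell_eq => x; rewrite cast2E.
- by move=> *; apply: twocell_eq => x; rewrite cast2E.
- by move=> *; apply: twocell_eq => x; rewrite cast2E.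
- by move=> *; apply: twocell_eq => x; rewrite cast2E.
- move=> A B C g g' f f' d e; apply: twocell_eq => x /=.
  by rewrite (map2_act e) -(map2_theta d) mulgKV.
Qed.

(* The 2-category of finite groups acting on finite sets. *)
Definition SS : twocat := TwoCat SS_laws.

(* The 1-cells whose [theta] is a fixed group homomorphism. *)
Section HomCell.
Variables (X Y : gset) (a : X -> Y) (f : {multiplicative grp X -> grp Y}).
Hypothesis a_act : forall x g, a (g *> x) = f g *> a x.

Fact hom_thetaM (x : X) (g g' : grp X) : f (g * g') = f g * f g'.
Proof. exact: gmulfM. Qed.

Definition hom_onecell : onecell X Y :=
  @OneCell X Y a (fun _ g => f g) a_act hom_thetaM.
End HomCell.

Section FiberProduct.

Variables (X Y Z : gset) (a : onecell X Z) (b : onecell Y Z).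

Definition fiber : finType :=
  {t : X * Y * grp Z | b t.1.2 == t.2 *> a t.1.1}.

Definition fiber_x (t : fiber) : X := (val t).1.1.
Definition fiber_y (t : fiber) : Y := (val t).1.2.
Definition fiber_k (t : fiber) : grp Z := (val t).2.

Fact fiber_act_subproof (gh : grp X * grp Y) (t : fiber) :
  b (gh.2 *> fiber_y t) ==
    (theta b (fiber_y t) gh.2 * fiber_k t * (theta a (fiber_x t) gh.1)^-1)
      *> a (gh.1 *> fiber_x t).
Proof.
by rewrite !map1_act -!lactM mulgKV lactM -(eqP (valP t)).
Qed.

Definition fiber_act (gh : grp X * grp Y) (t : fiber) : fiber :=
  Sub (gh.1 *> fiber_x t, gh.2 *> fiber_y t,
       theta b (fiber_y t) gh.2 * fiber_k t * (theta a (fiber_x t) gh.1)^-1)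
    (fiber_act_subproof gh t).

Fact fiber_act1 t : fiber_act 1 t = t.
Proof.
case: t => [[[x y] k] tP]; apply: val_inj.
by rewrite /= /fiber_x /fiber_y /fiber_k /= !lact1 !theta1 mul1g invg1 mulg1.
Qed.

Fact fiber_actM gh gh' t :
  fiber_act (gh * gh') t = fiber_act gh (fiber_act gh' t).
Proof.
by apply: val_inj; rewrite /= !lactM !thetaM invMg !mulgA.
Qed.

Definition fiber_gset : gset :=
  @GSet (grp X * grp Y)%type fiber fiber_act fiber_act1 fiber_actM.

Definition fiber_prX : onecell fiber_gset X :=
  @hom_onecell fiber_gset X fiber_x fst (fun _ _ => erefl).

Definition fiber_prY : onecell fiber_gset Y :=
  @hom_onecell fiber_gset Y fiber_y snd (fun _ _ => erefl).

Fact fiber_kappa_act (t : fiber_gset) :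
  comp_onecell b fiber_prY t = fiber_k t *> comp_onecell a fiber_prX t.
Proof. exact/eqP/(valP t). Qed.

Fact fiber_kappa_theta (t : fiber_gset) (gh : grp fiber_gset) :
  fiber_k (gh *> t) * theta (comp_onecell a fiber_prX) t gh * (fiber_k t)^-1
  = theta (comp_onecell b fiber_prY) t gh.
Proof. by rewrite /= /fiber_k /= mulgKV mulgK. Qed.

Definition fiber_kappa :
    twocell (comp_onecell a fiber_prX) (comp_onecell b fiber_prY) :=
  @TwoCell fiber_gset Z _ _ fiber_k fiber_kappa_act fiber_kappa_theta.

End FiberProduct.

(* Main.v *)
Require Import Defs.
From mathcomp Require Import all_boot all_fingroup.

Set Implicit Arguments.
Unset Strict Implicit.
Unset Printing Implicit Defensive.

Import GroupScope.

(** The set [F] is the fibre product of [X] and [Y] over [Z] in which equality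
    over [Z] is replaced by an element of [K] that moves one image to the
    other. A square over [alpha] and [beta] filled by a 2-cell [e] is, point by
    point, a triple [(g1 w, g2 w, e w)] in [F], and the naturality of [e] is
    exactly what makes this map, with the pair of cocycles of [g1] and [g2], a
    1-cell into [F / (G x H)] ([fiber_pairing]). Its composites with the
    projections are [g1] and [g2] on the nose, so identity 2-cells fill it.

    Since the acting group of [F] is [G x H], a 2-cell between 1-cells into [F]
    is nothing but a pair of 2-cells between their projections whose components
    are compatible with the coordinate in [K] ([fiber_twocell]). For two
    fillers [(g, xi1, xi2)] and [(g', xi1', xi2')] of one square, the equations
    asked of the comparison force its projections to be [xi1'^-1 xi1] and
    [xi2'^-1 xi2]; this gives uniqueness. These two 2-cells are compatible with
    the coordinate in [K] because the filler equations express [e], up to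
    [xi1] and [xi2], by that coordinate of [g], and likewise for [g']. *)

Section Pairing.

Variables (X Y Z : gset) (alpha : onecell X Z) (beta : onecell Y Z).
Variables (W : gset) (g1 : onecell W X) (g2 : onecell W Y).
Variable e : twocell (comp_onecell alpha g1) (comp_onecell beta g2).

Fact fiber_pairing_subproof w : beta (g2 w) == e w *> alpha (g1 w).
Proof. by apply/eqP; apply: (map2_act e). Qed.

Definition fiber_pairing_map (w : W) : fiber_gset alpha beta :=
  Sub (g1 w, g2 w, e w) (fiber_pairing_subproof w).

Definition fiber_pairing_theta (w : W) (u : grp W) :
    grp (fiber_gset alpha beta) := (theta g1 w u, theta g2 w u).

Fact fiber_pairing_act w u :
  fiber_pairing_map (u *> w) = fiber_pairing_theta w u *> fiber_pairing_map w.
Proof.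
apply: val_inj; rewrite /= /fiber_x /fiber_y /fiber_k /= !map1_act.
by rewrite -[theta beta _ _](map2_theta e) /= mulgKV mulgK.
Qed.

Fact fiber_pairing_thetaM w u u' :
  fiber_pairing_theta w (u * u') =
  fiber_pairing_theta (u' *> w) u * fiber_pairing_theta w u'.
Proof. by congr (_, _); apply: thetaM. Qed.

Definition fiber_pairing : onecell W (fiber_gset alpha beta) :=
  OneCell fiber_pairing_act fiber_pairing_thetaM.

End Pairing.

Section FiberTwoCell.

Variables (X Y Z : gset) (alpha : onecell X Z) (beta : onecell Y Z).
Variables (W : gset) (g g' : onecell W (fiber_gset alpha beta)).

Let prX := fiber_prX alpha beta.
Let prY := fiber_prY alpha beta.

Variables (u : twocell (comp_onecell prX g) (comp_onecell prX g')).
Variables (v : twocell (comp_onecell prY g) (comp_onecell prY g')).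

(** This is the equality of 2-cells
    [(beta \wl v) \v (kappa \wr g) = (kappa \wr g') \v (alpha \wl u)],
    evaluated at each point. *)
Hypothesis uv_kappa : forall w,
  theta beta (fiber_y (g w)) (v w) * fiber_k (g w) =
  fiber_k (g' w) * theta alpha (fiber_x (g w)) (u w).

Definition fiber_twocell_map (w : W) : grp (fiber_gset alpha beta) :=
  (u w, v w).

Fact fiber_twocell_act w : g' w = fiber_twocell_map w *> g w.
Proof.
apply: val_inj; rewrite /= uv_kappa mulgK.
rewrite -[u w *> _](map2_act u) -[v w *> _](map2_act v) /=.
by case: (g' w) => [[[]]].
Qed.

Fact fiber_twocell_theta w a :
  fiber_twocell_map (a *> w) * theta g w a * (fiber_twocell_map w)^-1 =
  theta g' w a.
Proof.
apply: injective_projections.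
- exact: (map2_theta u).
- exact: (map2_theta v).
Qed.

Definition fiber_twocell : twocell g g' :=
  TwoCell fiber_twocell_act fiber_twocell_theta.

End FiberTwoCell.

Lemma is_fillerE (X Y Z W : gset) (alpha : onecell X Z) (beta : onecell Y Z)
    (g1 : onecell W X) (g2 : onecell W Y)
    (e : twocell (comp_onecell alpha g1) (comp_onecell beta g2))
    (g : onecell W (fiber_gset alpha beta))
    (xi1 : twocell (comp_onecell (fiber_prX alpha beta) g) g1)
    (xi2 : twocell (comp_onecell (fiber_prY alpha beta) g) g2) :
  is_filler (C := SS) (fiber_kappa alpha beta) e xi1 xi2 <->
  forall w, e w * theta alpha (fiber_x (g w)) (xi1 w) =
            theta beta (fiber_y (g w)) (xi2 w) * fiber_k (g w).
Proof.
split=> [fill w | fill].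
  by have /(congr1 (fun d : twocell _ _ => d w)) := fill; rewrite /= cast2E.
by apply: twocell_eq => w; rewrite /= cast2E; apply: fill.
Qed.

(** At a point [w], the two filler equations compute [e w] from the coordinates
    in [K] of [g w] and of [g' w]. Eliminating [e w] between them relates these
    coordinates by the components of [xi1'^-1 xi1] and [xi2'^-1 xi2], through
    the cocycle identities of [alpha] and [beta]. *)
Lemma fillers_kappa (X Y Z W : gset)
    (alpha : onecell X Z) (beta : onecell Y Z)
    (g1 : onecell W X) (g2 : onecell W Y)
    (e : twocell (comp_onecell alpha g1) (comp_onecell beta g2))
    (g g' : onecell W (fiber_gset alpha beta))
    (xi1 : twocell (comp_onecell (fiber_prX alpha beta) g) g1)
    (xi2 : twocell (comp_onecell (fiber_prY alpha beta) g) g2)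
    (xi1' : twocell (comp_onecell (fiber_prX alpha beta) g') g1)
    (xi2' : twocell (comp_onecell (fiber_prY alpha beta) g') g2) :
  is_filler (C := SS) (fiber_kappa alpha beta) e xi1 xi2 ->
  is_filler (C := SS) (fiber_kappa alpha beta) e xi1' xi2' ->
  forall w,
    theta beta (fiber_y (g w)) (vcomp_twocell (inv_twocell xi2') xi2 w)
      * fiber_k (g w) =
    fiber_k (g' w)
      * theta alpha (fiber_x (g w)) (vcomp_twocell (inv_twocell xi1') xi1 w).
Proof.
move=> /is_fillerE fill /is_fillerE fill' w.
set u := vcomp_twocell _ xi1; set v := vcomp_twocell _ xi2.
have xi1E : xi1 w = xi1' w * u w by rewrite /= mulKVg.
have xi2E : xi2 w = xi2' w * v w by rewrite /= mulKVg.
have xE : fiber_x (g' w) = u w *> fiber_x (g w) := map2_act u w.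
have yE : fiber_y (g' w) = v w *> fiber_y (g w) := map2_act v w.
apply: (mulgI (theta beta (fiber_y (g' w)) (xi2' w))).
rewrite !mulgA -fill' yE -thetaM -xi2E -fill xE.
by rewrite -mulgA -thetaM -xi1E.
Qed.

Theorem proposition3p2p17 (X Y Z : gset)
  (alpha : onecell X Z) (beta : onecell Y Z) :
  is_bipullback SS alpha beta
    (fiber_prX alpha beta) (fiber_prY alpha beta) (fiber_kappa alpha beta).
Proof.
split=> [W g1 g2 e | W g1 g2 e g xi1 xi2 g' xi1' xi2' fill fill'].
  have prXE : comp_onecell (fiber_prX alpha beta) (fiber_pairing e) = g1.
    exact: onecell_eq.
  have prYE : comp_onecell (fiber_prY alpha beta) (fiber_pairing e) = g2.
    exact: onecell_eq.
  (* The composites with the projections equal [g1] and [g2] only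
     propositionally, so the identity 2-cells are transported. *)
  exists (fiber_pairing e).
  exists (cast2 (R := @twocell W X) erefl prXE (id_twocell _)).
  exists (cast2 (R := @twocell W Y) erefl prYE (id_twocell _)).
  by apply/is_fillerE => w; rewrite !cast2E /= !theta1 mulg1 mul1g.
exists (fiber_twocell (fillers_kappa fill fill')); split=> [|zeta [zeta1 zeta2]].
  by split; apply: twocell_eq => w /=; rewrite mulKVg.
apply: twocell_eq => w; rewrite [RHS]surjective_pairing /=.
by rewrite -zeta1 -zeta2 /fiber_twocell_map /= !mulKg.
Qed.
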